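(* Let $p\in[1,\infty]$ and let $V$ be an infinite dimensional closed subspace of $\ell_p$. Then $V\setminus Z(V)$ is maximal spaceable in $V$; that is, $(V\setminus Z(V))\cup\{0\}$ contains a closed linear subspace of $V$ of dimension $\dim(V)$.
   Context: All sequence spaces are over $\mathbb{C}$. For a space $V$ of sequences, $Z(V)$ denotes the set of all sequences in $V$ having only finitely many zero coordinates. Dimension means algebraic (Hamel) dimension. A subset $M$ of a topological vector space $X$ is spaceable in $X$ if there is an infinite dimensional closed linear subspace $Y$ of $X$ with $Y\subset M\cup\{0\}$; it is maximal spaceable if such a $Y$ can be chosen with $\dim(Y)=\dim(X)$. *)

(* Defs.v *)
From HB Require Import structures.
From mathcomp Require Import all_boot all_order all_algebra.
From mathcomp Require Import all_classical all_reals all_analysis.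
From mathcomp Require Import ess_sup_inf finmap complex.
Set Implicit Arguments.
Unset Strict Implicit.
Unset Printing Implicit Defensive.
Import Order.TTheory GRing.Theory Num.Theory.
Local Open Scope classical_set_scope.
Local Open Scope ring_scope.

Section LinearAlgebra.
Context {K : fieldType} {E : lmodType K}.
Implicit Types (B V W : set E).

Definition linear_subspace V : Prop := submod_closed (mem V).

Definition lin_independent B : Prop :=
  forall (s : seq E) (c : E -> K), uniq s -> [set` s] `<=` B ->
    \sum_(x <- s) c x *: x = 0 -> forall x, x \in s -> c x = 0.

Definition spanned_by B V : Prop :=
  forall v, V v -> exists (s : seq E) (c : E -> K),
    [set` s] `<=` B /\ v = \sum_(x <- s) c x *: x.

Definition hamel_basis B V : Prop :=
  [/\ B `<=` V, lin_independent B & spanned_by B V].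

Definition infinite_dim V : Prop :=
  ~ exists2 B, finite_set B & hamel_basis B V.

(* Hamel bases exist, and any two of the same subspace are equipotent, so the
   choice of the bases is immaterial. *)
Definition same_dim V W : Prop :=
  exists B C, [/\ hamel_basis B V, hamel_basis C W & (B #= C)%card].

End LinearAlgebra.

Section Spaceability.
Context {K : numFieldType} {E : topologicalLmodType K}.
Implicit Types (X M : set E).

(* X is a linear subspace of E, seen as a topological vector space for the
   induced topology: [closed (Y : set (subspace X))] is relative closedness. *)
Definition closed_subspace_in X M (Y : set E) : Prop :=
  [/\ linear_subspace Y, Y `<=` X, closed (Y : set (subspace X)),
      infinite_dim Y & Y `<=` M `|` [set 0]].

Definition spaceable X M : Prop := exists Y, closed_subspace_in X M Y.

Definition maximal_spaceable X M : Prop :=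
  exists2 Y, closed_subspace_in X M Y & same_dim Y X.

End Spaceability.

Section SequenceSpaces.
Context {R : realType}.
Local Notation C := (R[i]).
Local Notation normc := ComplexField.Normc.normc.
Implicit Types (p : \bar R) (x y : nat -> C^o).

Local Open Scope ereal_scope.

(* For 1 <= p <= +oo this is the usual (possibly infinite) l_p norm: see
   seq_norm_finE and seq_norm_ooE below. *)
Definition seq_norm p x : \bar R := 'N[counting]_p[EFin \o (fun n => normc (x n))].

Let normc_ge0 (z : C) : (0 <= normc z)%R.
Proof. by case: z => a b; exact: sqrtr_ge0. Qed.

Let ae_counting (P : set nat) : {ae @counting nat R, forall n, P n} -> forall n, P n.
Proof.
case=> B [mB B0 PB] n; apply: contrapT => nPn; have Bn : B n by exact: PB.
have : (@counting nat R) [set n] <= (@counting nat R) B.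
  by apply: le_measure; [exact: mem_set|exact: mem_set|move=> _ ->].
rewrite B0 /counting asboolT//; first by rewrite fset_set1 cardfs1 lee_fin ler10.
Qed.

Lemma seq_norm_finE (r : R) x : (1 <= r)%R ->
  seq_norm r%:E x = (\sum_(n <oo) (normc (x n) `^ r)%:E) `^ r^-1.
Proof.
move=> r1; rewrite /seq_norm Lnorm_counting ?(lt_le_trans ltr01)//.
congr (_ `^ _); apply: eq_eseriesr => n _.
by rewrite /= ger0_norm.
Qed.

Lemma seq_norm_ooE x : seq_norm +oo x = ereal_sup (range (fun n => (normc (x n))%:E)).
Proof.
have mu0 : 0 < (@counting nat R) [set: nat].
  by rewrite /counting asboolF//; exact: infinite_nat.
rewrite /seq_norm unlock /Lnorm ifT//.
apply/eqP; rewrite eq_le; apply/andP; split.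
  apply/ess_supP/nearW => n /=; rewrite ger0_norm//.
  by apply: ereal_sup_ubound; exists n.
apply: ge_ereal_sup => _ [n _ <-].
have := @ess_sup_ge _ _ _ (@counting nat R) (abse \o (EFin \o (fun n => normc (x n)))).
by move=> /ae_counting /(_ n); rewrite /= ger0_norm.
Qed.

Local Close Scope ereal_scope.

Definition in_lp p (p1 : (1 <= p)%E) : {pred nat -> C^o} :=
  [pred x | (seq_norm p x < +oo)%E].

Section Lp.
Variables (p : \bar R) (p1 : (1 <= p)%E).

Let le_seq_norm x y : (forall n, normc (x n) <= normc (y n)) ->
  (seq_norm p x <= seq_norm p y)%E.
Proof.
move=> xy; case: p p1 => [r| |]// r1; rewrite ?lee_fin in r1.
  rewrite !seq_norm_finE//.
  have r0 : 0 < r by exact: lt_le_trans r1.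
  have S0 z : (0 <= \sum_(n <oo) (normc (z n) `^ r)%:E)%E.
    by apply: nneseries_ge0 => n _ _; rewrite lee_fin powR_ge0.
  apply: gt0_ler_poweR; rewrite ?in_itv/= ?S0 ?leey ?invr_ge0 ?(ltW r0)//.
  apply: lee_nneseries => [n _ _|n _]; rewrite lee_fin ?powR_ge0//.
  by apply: ge0_ler_powR; rewrite ?nnegrE ?normc_ge0// ltW.
rewrite !seq_norm_ooE; apply: ge_ereal_sup => _ [n _ <-].
apply: le_trans (_ : (normc (y n))%:E <= _)%E; first by rewrite lee_fin.
by apply: ereal_sup_ubound; exists n.
Qed.

Lemma seq_normD x y : (seq_norm p (x + y)%R <= seq_norm p x + seq_norm p y)%E.
Proof.
have normcR (a : R) : 0 <= a -> normc a%:C%C = a.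
  by move=> a0; rewrite /= expr0n addr0 sqrtr_sqr ger0_norm.
pose z n : C^o := (normc (x n) + normc (y n))%:C%C.
have zE n : normc (z n) = normc (x n) + normc (y n) by rewrite normcR// addr_ge0.
apply: (@le_trans _ _ (seq_norm p z)).
  by apply: le_seq_norm => n; rewrite zE; exact: le_normcD.
rewrite [leLHS](_ : _ =
    'N[counting]_p[EFin \o ((fun n => normc (x n)) \+ (fun n => normc (y n)))%R])%E; last first.
  by apply: eq_Lnorm => n /=; rewrite -[LHS]/(normc (z n))%:E zE.
exact: (@eminkowski _ _ _ (@counting nat R)).
Qed.

Lemma seq_norm0 : seq_norm p 0%R = 0%E.
Proof.
rewrite /seq_norm -(@Lnorm0 _ _ _ (@counting nat R) p); last first.
  by rewrite gt_eqF// (lt_le_trans _ p1).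
by apply: eq_Lnorm => n /=; rewrite expr0n/= addr0 sqrtr0.
Qed.

Lemma seq_norm_eq0 x : seq_norm p x = 0%E -> x = 0%R.
Proof.
move=> x0; have : (EFin \o (fun n => normc (x n))) = \0%E %[ae @counting nat R].
  by apply: Lnorm_eq0_eq0 x0 => //; exact: lt_le_trans p1.
move=> /ae_counting h; apply/funext => n; apply: ComplexField.Normc.eq0_normc.
by have /(_ I) [] := h n.
Qed.

Lemma seq_normZ (a : C) x :
  (seq_norm p (a *: x)%R = (normc a)%:E * seq_norm p x)%E.
Proof.
have nZ n : normc ((a *: x) n)%R = normc a * normc (x n).
  exact: ComplexField.Normc.normcM.
case: p p1 => [r| |]// r1; rewrite ?lee_fin in r1.
  have r0 : 0 < r by exact: lt_le_trans r1.
  rewrite !seq_norm_finE//.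
  under eq_eseriesr do rewrite nZ powRM// EFinM.
  rewrite nneseriesZl; last by move=> n _; rewrite lee_fin powR_ge0.
  rewrite poweRM ?lee_fin ?powR_ge0//; last first.
    by apply: nneseries_ge0 => n _ _; rewrite lee_fin powR_ge0.
  by rewrite poweR_EFin -powRrM mulfV ?gt_eqF// powRr1.
rewrite !seq_norm_ooE -ereal_supZl//; last by apply/set0P; exists (normc (x 0%N))%:E; exists 0%N.
congr (ereal_sup _).
apply/seteqP; split=> [_ [n _ <-]|_ [_ [n _ <-] <-]]/=.
  by exists (normc (x n))%:E; [exists n|rewrite -EFinM -nZ].
by exists n => //; rewrite -EFinM -nZ.
Qed.

Let in_lp_submod_closed : submod_closed (in_lp p1).
Proof.
split; first by rewrite unfold_in/= seq_norm0 ltry.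
move=> a x y; rewrite !unfold_in/= => xp yp.
apply: le_lt_trans (seq_normD _ _) _.
by rewrite lte_add_pinfty// seq_normZ lte_mul_pinfty// lee_fin normc_ge0.
Qed.

HB.instance Definition _ :=
  GRing.isSubmodClosed.Build _ _ (in_lp p1) in_lp_submod_closed.

Record lp : Type := Lp { lp_val :> nat -> C^o; lp_valP : lp_val \in in_lp p1 }.

HB.instance Definition _ := [isSub for lp_val].
HB.instance Definition _ := [Choice of lp by <:].
HB.instance Definition _ := [SubChoice_isSubLmodule of lp by <:].

(* The norm of a normed module over C takes its values in C, hence the cast. *)
Definition lp_norm (x : lp) : C := (fine (seq_norm p x))%:C%C.

Let seq_norm_fin (x : lp) : seq_norm p x \is a fin_num.
Proof.
by rewrite ge0_fin_numE ?Lnorm_ge0//; have := lp_valP x; rewrite inE.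
Qed.

Let lp_normD (x y : lp) : lp_norm (x + y) <= lp_norm x + lp_norm y.
Proof.
rewrite /lp_norm -rmorphD lecR -lee_fin EFinD !fineK ?seq_norm_fin//.
exact: (seq_normD (lp_val x) (lp_val y)).
Qed.

Let lp_normZ (a : C) (x : lp) : lp_norm (a *: x) = `|a| * lp_norm x.
Proof.
have -> : `|a| = (normc a)%:C%C by case: a.
by rewrite /lp_norm -rmorphM/= (seq_normZ a (lp_val x)) fineM.
Qed.

Let lp_norm_eq0 (x : lp) : lp_norm x = 0 -> x = 0.
Proof.
move=> /(congr1 (@complex.Re R))/= x0; apply/val_inj/seq_norm_eq0.
by rewrite -[LHS]fineK// x0.
Qed.

HB.instance Definition _ :=
  Lmodule_isNormed.Build C lp lp_normD lp_normZ lp_norm_eq0.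

End Lp.

Definition finitely_many_zeros (p : \bar R) (p1 : (1 <= p)%E) (V : set (lp p1))
  : set (lp p1) := [set x | V x /\ finite_set [set n | x n = 0]].

End SequenceSpaces.

(* Main.v *)
Require Import Defs.
From HB Require Import structures.
From mathcomp Require Import all_boot all_order all_algebra.
From mathcomp Require Import all_classical all_reals all_analysis.
From mathcomp Require Import complex.
From mathcomp Require Import ring lra.
Set Implicit Arguments.
Unset Strict Implicit.
Unset Printing Implicit Defensive.
Import Order.TTheory GRing.Theory Num.Theory.
Import numFieldNormedType.Exports.
Local Open Scope classical_set_scope.
Local Open Scope ring_scope.

(** A closed subspace Y such that every element of Y has infinitely many zeros
   must, by Baire's theorem, have infinitely many zeros common to all its
   elements. So we look for an infinite set J of coordinates such that
   Y = [set x in V | x vanishes on J] is still infinite dimensional. Such a Y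
   is closed and avoids Z(V) by construction; what has to be shown is that
   independent vectors of V can be made to vanish on a common J.

   The vectors are corrected coordinate by coordinate. To kill the n-th
   coordinate of u at a small cost, we subtract (u n) z, where z in V vanishes
   on the coordinates already dealt with, z n = 1, and |u n| * ||z|| is tiny.
   Such n and z exist arbitrarily far out, for finitely many u at once
   (has_correctors), at least for the u in a suitable part A of V
   (exists_correctors).
   - If p is finite, A = V. If no such n and z existed, every x in V vanishing
     on a long initial segment would satisfy |x n| <= ||x|| h n for a fixed h
     in l_p. When the segment is so long that h has norm at most 1/2 beyond it,
     this gives ||x|| <= ||x|| / 2, although V contains nonzero such x.
   - If p is infinite, the tails of bounded sequences need not be small. Choose
     x_k in the unit ball of V and coordinates m_k with |x_k (m_k)| >= 1/2 and
     x_k vanishing on the earlier m_j, and a free ultrafilter U on the indices.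
     Let A consist of the x in V with x (m_k) --> 0 along U. For k < l the
     combination a_l x_k - a_k x_l, where a_k is the limit of x_k (m_j) along U,
     is in A and attains a fixed proportion of its norm at m_k or at m_l (if
     a_k = 0, take x_k itself); and k, l may be taken where the given elements
     of A are small.

   Iterating this yields vectors u_k and coordinates m_k forming a triangular
   system whose other half is as small as we like
   (exists_almost_biorthogonal). Take J = [set m_i | i odd] and correct
   every u_k with k even by the u_i with i odd: the corrections converge by
   completeness of l_p (lp_complete), and the limits y_k belong to Y and are
   still triangular on the coordinates m_k with k even (corrected_vector).

   For the dimension, both Y and V have dimension the continuum. On one hand
   l_p injects into the subsets of nat (lp_card_le). On the other hand, the
   sums over the members of an almost disjoint family of 2^aleph0 subsets of
   nat of the suitably scaled y_k are linearly independent elements of Y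
   (independent_continuum). Extending this family to a Hamel basis of Y and
   then to one of V, the Cantor-Bernstein theorem concludes. *)

(** * Hamel bases and dependent choice *)

Section HamelBases.
Context {K : fieldType} {E : lmodType K}.
Implicit Types (B V : set E) (e v : E).

Definition in_span B v : Prop := exists (s : seq E) (c : E -> K),
  [set` s] `<=` B /\ v = \sum_(x <- s) c x *: x.

Lemma lin_independentU1 B e :
  lin_independent B -> ~ in_span B e -> lin_independent (B `|` [set e]).
Proof.
move=> indB eB s c us sB sum0.
have sB' x : x \in s -> x != e -> B x by move=> /sB[//|->]; rewrite eqxx.
have [es|es] := boolP (e \in s); last first.
  apply: (indB s) => // x xs; apply: sB' => //.
  by apply: contraNneq es => <-.
rewrite (bigD1_seq e)//= -big_filter in sum0.
have fB : [set` [seq x <- s | x != e]] `<=` B.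
  by move=> x /=; rewrite mem_filter => /andP[xe xs]; exact: sB'.
have ce0 : c e = 0.
  apply/eqP/negP => /negP ce0; apply: eB.
  exists [seq x <- s | x != e], (fun x => - (c e)^-1 * c x); split => //.
  under eq_bigr do rewrite -scalerA.
  rewrite -scaler_sumr; apply: (scalerI ce0); rewrite scalerA mulrN divff//.
  by rewrite scaleN1r; apply/eqP; rewrite -addr_eq0 sum0.
move=> x xs; have [->//|xe] := eqVneq x e.
apply: (indB [seq x <- s | x != e] c) => //; first exact: filter_uniq.
  by rewrite ce0 scale0r add0r in sum0.
by rewrite mem_filter xe.
Qed.

(** Zorn's lemma is applied to the sets X such that B `|` X is independent,
   rather than to the independent sets containing B: the empty chain then needs
   no special treatment. *)
Lemma hamel_basis_extend V B : linear_subspace V -> B `<=` V ->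
  lin_independent B -> exists2 C, B `<=` C & hamel_basis C V.
Proof.
move=> lV BV indB.
have [F FP Ftot|A [[AV indA] Amax]] :=
  @Zorn_bigcup E [set X | X `<=` V /\ lin_independent (B `|` X)].
  split=> [x [X /FP[XV _] /XV//]|s c us sF].
  (* a finite part of the union of a chain lies in a single member of it *)
  have [X [FX|->] sX] : exists2 X, F X \/ X = set0 & [set` s] `<=` B `|` X.
    elim: s {us} sF => [|x s IH] sF; first by exists set0; [right|].
    have [|X XF sX] := IH.
      by move=> y ys; apply: sF; rewrite /= inE (_ : y \in s) ?orbT.
    have {}sX X' : X `<=` X' -> [set` s] `<=` B `|` X'.
      by move=> XX' y /sX[]; [left|right; exact: XX'].
    have /sF[Bx|[X' FX' X'x]] : [set` x :: s] x by rewrite /= inE eqxx.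
      by exists X => // y /=; rewrite inE => /orP[/eqP ->|]; [left|exact: sX].
    have [X'X|XX'] : X' `<=` X \/ X `<=` X'.
    - by case: XF => [|->]; [exact: Ftot|right].
    - exists X => // y /=; rewrite inE => /orP[/eqP ->|]; last exact: sX.
      by right; exact: X'X.
    - exists X'; first by left.
      by move=> y /=; rewrite inE => /orP[/eqP ->|]; [right|exact: sX].
  - by have [_] := FP _ FX; apply.
  - by move: sX; rewrite setU0; exact: indB.
exists (B `|` A); first by move=> x; left.
split=> [x [/BV//|/AV//]|//|v Vv]; apply: contrapT => vB.
have nv : ~ (B `|` A) v.
  move=> Bv; apply: vB; exists [:: v], (fun=> 1); split.
    by move=> x /=; rewrite inE => /eqP ->.
  by rewrite big_seq1 scale1r.
apply: (Amax (A `|` [set v])).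
  split; first by move=> x; left.
  by move=> /(_ v) vA; apply: nv; right; apply: vA; right.
split=> [x [/AV//|->//]|]; rewrite setUA; exact: lin_independentU1.
Qed.

(** More vectors than generators are linearly dependent: the matrix of their
   coordinates has a non-trivial left kernel. *)
Lemma infinite_dim_seq V (y : nat -> E) : injective y -> range y `<=` V ->
  lin_independent (range y) -> infinite_dim V.
Proof.
move=> yI yV indy [B /finite_seqP[b ->] [_ _ Bspan]].
have /choice[c yc] k : exists c : E -> K, y k = \sum_(x <- undup b) c x *: x.
  have /Bspan[s [c [sb ->]]] : V (y k) by apply: yV; exists k.
  (* s may have repetitions, which are merged here *)
  exists (fun x => c x *+ count_mem x s).
  elim: s sb => [|x s IH] sb.
    by rewrite big_nil big1 // => x _; rewrite mulr0n scale0r.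
  rewrite big_cons IH; last first.
    by move=> z zs; apply: sb; rewrite /= inE (_ : z \in s) ?orbT.
  have xb : x \in undup b by rewrite mem_undup; apply: sb; rewrite /= inE eqxx.
  under [RHS]eq_bigr do rewrite mulrnDr scalerDl.
  rewrite big_split/=; congr (_ + _).
  rewrite (bigD1_seq x) ?undup_uniq//= eqxx mulr1n big1 ?addr0// => z.
  by rewrite eq_sym => /negbTE ->; rewrite mulr0n scale0r.
set d := size (undup b).
pose A := \matrix_(i < d.+1, j < d) c i (nth 0 (undup b) j).
have : \rank (kermx A) != 0.
  by rewrite mxrank_ker subn_eq0 -ltnNge ltnS rank_leq_col.
rewrite mxrank_eq0 => /rowV0Pn[w wA w0].
have {}wA : w *m A = 0 by apply/sub_kermxP.
pose l (x : E) := \sum_(i < d.+1 | y i == x) w 0 i.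
have ly (i : 'I_d.+1) : l (y i) = w 0 i.
  rewrite /l (bigD1 i)//= big1 ?addr0// => j /andP[/eqP/yI/val_inj ->].
  by rewrite eqxx.
have l0 : forall x, x \in [seq y i | i <- iota 0 d.+1] -> l x = 0.
  apply: indy; first by rewrite map_inj_uniq ?iota_uniq.
    by move=> x /mapP[k kd xk]; exists k.
  rewrite big_map -[iota 0 _]/(index_iota 0 d.+1) big_mkord.
  under eq_bigr do rewrite ly yc scaler_sumr.
  rewrite exchange_big/= (big_nth 0) big_mkord big1// => j _.
  under eq_bigr do rewrite scalerA.
  rewrite -scaler_suml; have /matrixP/(_ 0 j) := wA.
  rewrite !mxE => wAj; rewrite [X in X *: _](_ : _ = 0) ?scale0r// -[RHS]wAj.
  by apply: eq_bigr => i _; rewrite mxE.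
move/negP: w0; apply; apply/eqP/rowP => i; rewrite mxE -ly; apply: l0.
by apply: map_f; rewrite mem_iota /= add0n.
Qed.

Lemma linear_subspaceD V u v : linear_subspace V -> V u -> V v -> V (u + v).
Proof.
by move=> [_ lV] Vu Vv; have := lV 1 u v; rewrite scale1r !inE; exact.
Qed.

Lemma linear_subspaceZ V a u : linear_subspace V -> V u -> V (a *: u).
Proof.
by move=> [V0 lV] Vu; have := lV a u 0; rewrite addr0 !inE in V0 *; exact.
Qed.

Lemma linear_subspaceB V u v : linear_subspace V -> V u -> V v -> V (u - v).
Proof.
move=> lV Vu Vv; rewrite -scaleN1r; apply: linear_subspaceD => //.
exact: linear_subspaceZ.
Qed.

(** A subspace on which finitely many functionals separate the points is finite
   dimensional; each functional costs at most one basis vector. *)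
Lemma infinite_dim_kernel V (f : nat -> E -> K) (N : nat) :
  (forall i, scalar (f i)) -> linear_subspace V -> infinite_dim V ->
  exists x, [/\ V x, x != 0 & forall i, (i < N)%N -> f i x = 0].
Proof.
move=> flin lV infV; apply: contrapT => noX; apply: infV.
have : forall x, V x -> (forall i, (i < N)%N -> f i x = 0) -> x = 0.
  move=> x Vx fx; apply/eqP/negP => /negP x0; apply: noX; exists x; split => //.
elim: N V lV {noX} => [|N IH] V lV Vinj.
  exists set0 => //; split => //.
    by move=> s c _ s0 _ x /s0.
  move=> v Vv; exists [::], (fun=> 0); split => //.
  by rewrite big_nil; apply: Vinj.
have f0 i : f i 0 = 0 by have := flin i (-1) 0 0; rewrite scaler0 add0r mulN1r addNr.
pose V' : set E := [set x | V x /\ f N x = 0].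
have lV' : linear_subspace V'.
  split; first by rewrite inE; split; [case: lV; rewrite inE|].
  move=> a u v; rewrite !inE => -[Vu fu] [Vv fv]; split.
    by apply: linear_subspaceD => //; exact: linear_subspaceZ.
  by rewrite flin fu fv mulr0 addr0.
have [x [Vx fx] xi|B finB [BV' indB spanB]] := IH V' lV'.
  by apply: Vinj => // i; rewrite ltnS leq_eqVlt => /predU1P[->//|]; exact: xi.
have [V'V|/existsNP[e /not_implyP[Ve V'e]]] := pselect (V `<=` V').
  exists B => //; split => // [x /BV'[]//|v /V'V]; exact: spanB.
have fe : f N e != 0 by apply/eqP => fe; exact: V'e.
have Be : ~ in_span B e.
  move=> [s [c [sB es]]]; move/eqP: fe; apply; rewrite {}es.
  elim: s sB => [|x s IHs] sB; first by rewrite big_nil.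
  rewrite big_cons flin IHs; last first.
    by move=> z zs; apply: sB; rewrite /= inE (_ : z \in s) ?orbT.
  have /sB/BV'[_ ->] : [set` x :: s] x by rewrite /= inE eqxx.
  by rewrite mulr0 addr0.
exists (B `|` [set e]); first by rewrite finite_setU.
split; first by move=> x [/BV'[]//|->].
  exact: lin_independentU1.
move=> v Vv; pose a := f N v / f N e.
have [|s [c [sB vs]]] := spanB (v - a *: e).
  split; first by apply: linear_subspaceB => //; exact: linear_subspaceZ.
  rewrite -scalerN -scaleN1r scalerA mulrN1 addrC flin /a mulNr divfK//.
  by rewrite addNr.
have es : e \notin s by apply/negP => /sB /BV' /V'e.
exists (e :: s), (fun x => if x == e then a else c x); split.
  by move=> x /=; rewrite inE => /orP[/eqP ->|/sB]; [right|left].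
rewrite big_cons eqxx -[LHS](subrK (a *: e)) addrC vs; congr (_ + _).
by apply: eq_big_seq => x xs; case: eqP => // xe; rewrite -xe xs in es.
Qed.

End HamelBases.

Lemma history_choice (T : choiceType) (Q : set T) (P : seq T -> T -> Prop) :
  (forall s, (forall x, x \in s -> Q x) -> exists2 x, Q x & P s x) ->
  exists f : nat -> T, forall i, Q (f i) /\ P (mkseq f i) (f i).
Proof.
move=> ex; have [x0 _ _] := ex [::] (fun _ => ltac:(by [])).
have /choice[g gP] s : exists x, (forall x, x \in s -> Q x) -> Q x /\ P s x.
  have [Qs|nQs] := pselect (forall x, x \in s -> Q x); last by exists x0.
  by have [x Qx Px] := ex s Qs; exists x.
pose h := fix h i := if i is j.+1 then rcons (h j) (g (h j)) else [::].
exists (fun i => g (h i)) => i.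
have hE j : h j = mkseq (fun i => g (h i)) j.
  by elim: j => //= j IH; rewrite mkseqS -IH.
rewrite -hE; apply: (gP _); elim: i => //= i IH x.
by rewrite mem_rcons inE => /orP[/eqP ->|/IH//]; have [] := gP _ IH.
Qed.

(** * Norms of sequences *)

Section LpNorm.
Context {R : realType}.
Local Notation C := (R[i]).
Local Notation normc := (@ComplexField.Normc.normc R).
Implicit Types (x y : nat -> C^o) (M : R).

Lemma normc_ge0 (z : C) : 0 <= normc z.
Proof. by case: z => a b; exact: sqrtr_ge0. Qed.

Lemma normC_normc (z : C) : `|z| = (normc z)%:C%C.
Proof. by case: z. Qed.

Lemma normc_real (a : R) : 0 <= a -> normc a%:C%C = a.
Proof. by move=> a0; rewrite /= expr0n addr0 sqrtr_sqr ger0_norm. Qed.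

Lemma normc_gt0 (z : C) : (0 < normc z) = (z != 0).
Proof.
rewrite lt_neqAle normc_ge0 andbT eq_sym; congr (~~ _).
apply/eqP/eqP => [/ComplexField.Normc.eq0_normc//|->].
exact: ComplexField.Normc.normc0.
Qed.

Lemma seq_norm_ge0 p x : (0 <= seq_norm p x)%E.
Proof. exact: Lnorm_ge0. Qed.

(** This and the next lemma turn norm bounds into conditions on finitely many
   coordinates at a time, the form in which they pass to coordinatewise limits. *)
Lemma seq_norm_fin_le (r : R) x M : 1 <= r -> 0 <= M ->
  (seq_norm r%:E x <= M%:E)%E <->
  forall K, \sum_(0 <= n < K) normc (x n) `^ r <= M `^ r.
Proof.
move=> r1 M0; have r0 : 0 < r by exact: lt_le_trans r1.
rewrite seq_norm_finE//.
set S := (\sum_(n <oo) _)%E.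
have S0 : (0 <= S)%E by apply: nneseries_ge0 => n _ _; rewrite lee_fin powR_ge0.
have -> : ((S `^ r^-1 <= M%:E) = (S <= (M `^ r)%:E))%E.
  rewrite -poweR_EFin; apply/idP/idP => h.
    have -> : S = ((S `^ r^-1) `^ r)%E.
      by rewrite -poweRrM mulVf ?gt_eqF// poweRe1.
    by apply: gt0_ler_poweR; rewrite ?in_itv/= ?leey ?poweR_ge0 ?lee_fin ?M0 ?(ltW r0).
  have -> : (M%:E = (M%:E `^ r) `^ r^-1)%E.
    by rewrite -poweRrM mulfV ?gt_eqF// poweRe1// lee_fin.
  apply: gt0_ler_poweR; rewrite ?invr_ge0 ?(ltW r0)// in_itv/= leey andbT//.
  by rewrite lee_fin powR_ge0.
split=> [h K|h].
  rewrite -lee_fin; apply: le_trans h; rewrite -sumEFin.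
  by apply: nneseries_lim_ge => n _ _; rewrite lee_fin powR_ge0.
apply: lime_le.
  by apply: is_cvg_nneseries => n _ _; rewrite lee_fin powR_ge0.
by apply: nearW => K; rewrite sumEFin lee_fin.
Qed.

Lemma seq_norm_oo_le x M :
  (seq_norm +oo x <= M%:E)%E <-> forall n, normc (x n) <= M.
Proof.
rewrite seq_norm_ooE; split=> [h n|h].
  by rewrite -lee_fin; apply: le_trans h; apply: ereal_sup_ubound; exists n.
by apply: ge_ereal_sup => _ [n _ <-]; rewrite lee_fin.
Qed.

Lemma p_fin_or_oo (p : \bar R) : (1 <= p)%E ->
  (exists2 r, p = r%:E & 1 <= r) \/ p = +oo%E.
Proof. by case: p => [r| |]//; [left; exists r|right]. Qed.

Definition truncate (K : nat) x : nat -> C^o := fun n => if (n < K)%N then x n else 0.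

Definition unit_seq (k : nat) : nat -> C^o := fun n => (n == k)%:R.

Section FixedExponent.
Variables (p : \bar R) (p1 : (1 <= p)%E).

Lemma seq_norm_mono x y : (forall n, normc (x n) <= normc (y n)) ->
  (seq_norm p x <= seq_norm p y)%E.
Proof.
move=> xy; have := seq_norm_ge0 p y.
case Ey : (seq_norm p y) => [M| |] // M0; last by rewrite leey.
rewrite lee_fin in M0.
case: (p_fin_or_oo p1) => [[r pr r1]|pr]; rewrite pr in Ey *.
  apply/(seq_norm_fin_le _ r1 M0) => K.
  have /(seq_norm_fin_le _ r1 M0)/(_ K) : (seq_norm r%:E y <= M%:E)%E by rewrite Ey.
  apply: le_trans; apply: ler_sum => n _.
  by apply: ge0_ler_powR; rewrite ?nnegrE ?normc_ge0// (le_trans _ r1).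
apply/seq_norm_oo_le => n; apply: le_trans (xy n) _.
by move: n; apply/seq_norm_oo_le; rewrite Ey.
Qed.

Lemma seq_norm_truncate x M : 0 <= M ->
  (forall K, seq_norm p (truncate K x) <= M%:E)%E -> (seq_norm p x <= M%:E)%E.
Proof.
move=> M0 h; case: (p_fin_or_oo p1) => [[r pr r1]|pr]; rewrite pr in h *.
  apply/(seq_norm_fin_le _ r1 M0) => K.
  have /(seq_norm_fin_le _ r1 M0)/(_ K) := h K; apply: le_trans.
  rewrite le_eqVlt; apply/orP; left; apply/eqP; apply: eq_big_nat => n /andP[_ nK].
  by rewrite /truncate nK.
apply/seq_norm_oo_le => n; have /seq_norm_oo_le/(_ n) := h n.+1.
by rewrite /truncate ltnSn.
Qed.

Lemma seq_norm_unit k : (seq_norm p (unit_seq k) <= 1%:E)%E.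
Proof.
case: (p_fin_or_oo p1) => [[r pr r1]|pr]; rewrite pr.
  apply/(seq_norm_fin_le _ r1 ler01) => K; rewrite powR1.
  have e0 n : n != k -> normc (unit_seq k n) `^ r = 0.
    move=> /negbTE nk; rewrite /unit_seq nk ComplexField.Normc.normc0 powR0//.
    by rewrite gt_eqF// (lt_le_trans ltr01).
  have e1 : normc (unit_seq k k) `^ r = 1.
    by rewrite /unit_seq eqxx ComplexField.Normc.normc1 powR1.
  have [kK|Kk] := ltnP k K.
    rewrite (bigD1_seq k) ?iota_uniq ?mem_index_iota//= e1 big1 ?addr0//.
  rewrite big_nat big1// => n /andP[_ nK].
  by rewrite e0// ltn_eqF// (leq_trans nK).
apply/seq_norm_oo_le => n; rewrite /unit_seq; case: eqP => _.
  by rewrite ComplexField.Normc.normc1.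
by rewrite ComplexField.Normc.normc0.
Qed.

Lemma normc_le_seq_norm x n : ((normc (x n))%:E <= seq_norm p x)%E.
Proof.
have := seq_norm_ge0 p x.
case Ex : (seq_norm p x) => [M| |] // M0; last by rewrite leey.
rewrite lee_fin in M0 *.
case: (p_fin_or_oo p1) => [[r pr r1]|pr]; rewrite pr in Ex.
  have : (seq_norm r%:E x <= M%:E)%E by rewrite Ex.
  move=> /(seq_norm_fin_le _ r1 M0)/(_ n.+1); rewrite big_nat_recr//= => h.
  have {}h : normc (x n) `^ r <= M `^ r.
    by apply: le_trans h; rewrite lerDr sumr_ge0// => i _; exact: powR_ge0.
  rewrite leNgt; apply/negP => lt.
  have := gt0_ltr_powR (lt_le_trans ltr01 r1) _ _ lt.
  by rewrite !nnegrE normc_ge0 M0 => /(_ isT isT); rewrite ltNge h.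
by move: n; apply/seq_norm_oo_le; rewrite Ex.
Qed.

Lemma seq_norm_truncate_le_sum x K :
  (seq_norm p (truncate K x) <= (\sum_(0 <= n < K) normc (x n))%:E)%E.
Proof.
elim: K => [|K IH].
  rewrite big_nil (_ : truncate 0 x = 0) ?seq_norm0//.
rewrite (_ : truncate K.+1 x = truncate K x + x K *: unit_seq K); last first.
  apply/funext => n; rewrite /truncate /= fctE ltnS leq_eqVlt.
  change ((if (n == K) || (n < K)%N then x n else 0) =
    (if (n < K)%N then x n else 0) + x K * (n == K)%:R).
  by case: eqP => [->|_] /=; rewrite ?ltnn ?add0r ?mulr1// mulr0 addr0.
apply: le_trans (seq_normD p1 _ _) _; rewrite big_nat_recr//= EFinD leeD//.
rewrite (seq_normZ p1) -[leRHS]mule1 lee_pmul// ?seq_norm_ge0 ?lee_fin ?normc_ge0//.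
exact: seq_norm_unit.
Qed.

(** The norm is lower semicontinuous for coordinatewise convergence: finitely
   many coordinates of the limit are close to those of some term. *)
Lemma seq_norm_lsc x (f : nat -> nat -> C^o) M : 0 <= M ->
  (forall j, seq_norm p (f j) <= M%:E)%E ->
  (forall n e, 0 < e -> exists J, forall j, (J <= j)%N -> normc (x n - f j n) <= e) ->
  (seq_norm p x <= M%:E)%E.
Proof.
move=> M0 fM fx; apply: seq_norm_truncate => // K.
apply/lee_addgt0Pr => e e0.
have [j hj] : exists j, forall n, (n < K)%N -> normc (x n - f j n) <= e / K.+1%:R.
  suff [J hJ] : exists J, forall j n, (J <= j)%N -> (n < K)%N ->
      normc (x n - f j n) <= e / K.+1%:R.
    by exists J => n; exact: hJ.
  have eK : 0 < e / K.+1%:R by rewrite divr_gt0.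
  elim: {1}K => [|k [J hJ]]; first by exists 0%N.
  have [J' hJ'] := fx k _ eK; exists (maxn J J') => j n.
  rewrite geq_max => /andP[Jj J'j]; rewrite ltnS leq_eqVlt => /predU1P[->|nk].
    exact: hJ'.
  exact: hJ.
rewrite (_ : truncate K x = truncate K (f j) + truncate K (x - f j)); last first.
  apply/funext => n; rewrite /truncate fctE.
  change ((if (n < K)%N then x n else 0) =
    (if (n < K)%N then f j n else 0) + (if (n < K)%N then x n - f j n else 0)).
  by case: ifP => _; rewrite ?addr0// addrC subrK.
apply: le_trans (seq_normD p1 _ _) _; apply: leeD.
  apply: le_trans (fM j); apply: seq_norm_mono => n; rewrite /truncate.
  by case: ifP => // _; rewrite ComplexField.Normc.normc0 normc_ge0.
apply: le_trans (seq_norm_truncate_le_sum _ _) _; rewrite lee_fin.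
apply: (@le_trans _ _ (\sum_(0 <= n < K) e / K.+1%:R)).
  by rewrite !big_nat; apply: ler_sum => n /andP[_ nK]; exact: hj.
rewrite sumr_const_nat subn0. rewrite -[leLHS]mulr_natr -mulrA ger_pMr//.
by rewrite mulrC ler_pdivrMr// mul1r ler_nat.
Qed.

End FixedExponent.
End LpNorm.

(** * Completeness and closedness in l_p *)

Section DyadicCauchy.
Context {R : realType}.

Lemma dyadic_small (e : R) : 0 < e -> exists J, forall j, (J <= j)%N -> 2^-1 ^+ j < e.
Proof.
move=> e0; exists (Num.truncn e^-1).+1 => j Jj.
rewrite exprVn invf_plt ?posrE ?exprn_gt0//.
apply: (lt_le_trans (truncnS_gt _)).
by rewrite -natrX ler_nat (leq_trans Jj)// ltnW// ltn_expl.
Qed.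

(** The intervals of centre a i and radius 2 / 2 ^ i are nested, and the
   supremum l of their left ends lies in all of them. *)
Lemma dyadic_cauchy_cvg (a : nat -> R) :
  (forall i, `|a i.+1 - a i| <= 2^-1 ^+ i) ->
  exists l, forall i, `|l - a i| <= 2 * 2^-1 ^+ i.
Proof.
move=> ha.
have half i : 2^-1 ^+ i.+1 = 2^-1 * 2^-1 ^+ i :> R by rewrite exprS.
have pos i : 0 <= 2^-1 ^+ i :> R by rewrite exprn_ge0.
pose b i := a i - 2 * 2^-1 ^+ i; pose c i := a i + 2 * 2^-1 ^+ i.
have bS : nondecreasing_seq b.
  apply/nondecreasing_seqP => i; rewrite /b half.
  by have := ha i; rewrite ler_norml => /andP[? ?]; lra.
have cS : nonincreasing_seq c.
  apply/nonincreasing_seqP => i; rewrite /c half.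
  by have := ha i; rewrite ler_norml => /andP[? ?]; lra.
have bc i j : b i <= c j.
  apply: (le_trans (bS _ (maxn i j) (leq_maxl _ _))).
  apply: (le_trans _ (cS j (maxn i j) (leq_maxr _ _))).
  by rewrite /b /c; have := pos (maxn i j); lra.
have ubb i : ubound (range b) (c i) by move=> _ [j _ <-].
exists (sup (range b)) => i.
have h1 : b i <= sup (range b) by apply: ub_le_sup; [exists (c 0%N)|exists i].
have h2 : sup (range b) <= c i by apply: ge_sup => //; exists (b 0%N); exists 0%N.
by rewrite /b /c in h1 h2; rewrite ler_norml; apply/andP; split; lra.
Qed.

End DyadicCauchy.

Section LpSpace.
Context {R : realType}.
Local Notation C := (R[i]).
Local Notation normc := (@ComplexField.Normc.normc R).
Variables (p : \bar R) (p1 : (1 <= p)%E).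
Implicit Types (x y z : lp p1) (V : set (lp p1)).

(** The norm of l_p with values in R, where the order is total. *)
Definition lpN x : R := fine (seq_norm p x).

Lemma lp_normE x : `|x| = (lpN x)%:C%C. Proof. by []. Qed.

Lemma lpNE x : (lpN x)%:E = seq_norm p x.
Proof.
rewrite /lpN fineK// ge0_fin_numE ?seq_norm_ge0//.
by have := lp_valP x; rewrite inE.
Qed.

Lemma lpN_ge0 x : 0 <= lpN x.
Proof. by rewrite -lee_fin lpNE seq_norm_ge0. Qed.

Lemma lpND x y : lpN (x + y) <= lpN x + lpN y.
Proof. by rewrite -lecR rmorphD -!lp_normE ler_normD. Qed.

Lemma lpNZ a x : lpN (a *: x) = normc a * lpN x.
Proof.
by apply: complexI; rewrite rmorphM -!lp_normE normrZ normC_normc.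
Qed.

Lemma lpN0 : lpN 0 = 0.
Proof. by apply: complexI; rewrite -lp_normE normr0. Qed.

Lemma lpN_gt0 x : (0 < lpN x) = (x != 0).
Proof. by rewrite -ltcR -lp_normE normr_gt0. Qed.

Lemma normc_le_lpN x n : normc (x n) <= lpN x.
Proof. by rewrite -lee_fin lpNE normc_le_seq_norm. Qed.

Lemma lp_mk (f : nat -> C^o) : (seq_norm p f < +oo)%E ->
  exists x, lp_val x = f.
Proof. by move=> fp; exists (@Lp _ _ p1 f fp). Qed.

Lemma lp_eval_lin (n : nat) : scalar (fun x => x n : C).
Proof. by []. Qed.

Lemma lp_evalD x y n : (x + y) n = x n + y n. Proof. by []. Qed.
Lemma lp_evalB x y n : (x - y) n = x n - y n. Proof. by []. Qed.
Lemma lp_evalZ (a : C) x n : (a *: x) n = a * x n. Proof. by []. Qed.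

Lemma lp_eval_sum (I : Type) (r : seq I) (f : I -> lp p1) n :
  (\sum_(i <- r) f i) n = \sum_(i <- r) f i n.
Proof.
by elim: r => [|i r IH]; rewrite ?big_nil// !big_cons lp_evalD IH.
Qed.

(** Coordinates converge because each of them is bounded by the norm; lower
   semicontinuity of the norm upgrades this to convergence in norm. *)
Lemma lp_complete (v : nat -> lp p1) :
  (forall i, lpN (v i.+1 - v i) <= 2^-1 ^+ i) ->
  exists y, forall i, lpN (y - v i) <= 2 * 2^-1 ^+ i.
Proof.
move=> hv.
have tel i k : lpN (v (i + k)%N - v i) <= 2 * 2^-1 ^+ i - 2 * 2^-1 ^+ (i + k).
  elim: k => [|k IH]; first by rewrite addn0 !subrr lpN0.
  rewrite -[v _ - v i](subrKA (v (i + k)%N)) addnS; apply: le_trans (lpND _ _) _.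
  apply: le_trans (lerD (hv _) IH) _.
  by rewrite exprS; have : 0 <= 2^-1 ^+ (i + k) :> R by []; lra.
have /choice[l hl] n : exists l : C, forall e, 0 < e ->
    exists J, forall j, (J <= j)%N -> normc (l - v j n) <= e.
  have comp (f : C -> R) : {morph f : a b / a - b} ->
      (forall w : C, `|f w| <= normc w) ->
      exists l, forall i, `|l - f (v i n)| <= 2 * 2^-1 ^+ i.
    move=> fB fn; apply: dyadic_cauchy_cvg => i.
    rewrite -fB; apply: le_trans (fn _) _.
    exact: le_trans (normc_le_lpN (v i.+1 - v i) n) (hv i).
  have sq (a b : R) : `|a| <= Num.sqrt (a ^+ 2 + b ^+ 2).
    by rewrite -sqrtr_sqr ler_wsqrtr// lerDl sqr_ge0.
  have [|[a b]|a ha] := comp (@complex.Re R); first by move=> [? ?] [? ?].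
    exact: sq.
  have [|[c d]|b hb] := comp (@complex.Im R); first by move=> [? ?] [? ?].
    by rewrite /= addrC; exact: sq.
  exists (a +i* b)%C => e e0.
  have [J hJ] := @dyadic_small R (e / 4) ltac:(by rewrite divr_gt0).
  exists J => j /hJ Jj; have := ha j; have := hb j.
  case: (v j n) => c d /= hd hc.
  apply: (@le_trans _ _ (`|a - c| + `|b - d|)); last first.
    by apply: le_trans (lerD hc hd) _; lra.
  rewrite -[leRHS]ger0_norm ?addr_ge0// -sqrtr_sqr ler_wsqrtr//.
  rewrite -(real_normK (num_real (a - c))) -(real_normK (num_real (b - d))).
  by have := normr_ge0 (a - c); have := normr_ge0 (b - d); nra.
have key i : (seq_norm p (l - v i)%R <= (2 * 2^-1 ^+ i)%:E)%E.
  apply: (@seq_norm_lsc _ _ p1 _ (fun j => v (i + j)%N - v i)) => //.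
  - move=> j; rewrite -lpNE lee_fin; apply: le_trans (tel i j) _.
    by rewrite gerBl mulr_ge0.
  - move=> n e /(hl n)[J hJ]; exists J => j Jj.
    rewrite (_ : _ - _ = l n - v (i + j)%N n).
      by apply: hJ; rewrite (leq_trans Jj)// leq_addl.
    change (l n - v i n - (v (i + j)%N n - v i n) = l n - v (i + j)%N n).
    ring.
have [y0 y0E] : exists y0, lp_val y0 = l - v 0%N.
  by apply: lp_mk; apply: le_lt_trans (key 0%N) _; rewrite ltry.
exists (y0 + v 0%N) => i; rewrite -lee_fin lpNE.
rewrite (_ : lp_val _ = l - v i); first exact: key.
apply/funext => n; change (y0 n + v 0%N n - v i n = l n - v i n).
by rewrite y0E -[(l - v 0%N) n]/(l n - v 0%N n) subrK.
Qed.

Lemma closed_lpP V :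
  closed V <-> forall y, (forall e, 0 < e -> exists2 x, V x & lpN (y - x) < e) -> V y.
Proof.
split=> [cV y hy|h y cy].
  apply: cV => B /nbhs_normP[[a b] /=]; rewrite ltcE /= => /andP[/eqP b0 a0] yB.
  have [x Vx xy] := hy a a0; exists x; split => //; apply: yB.
  by rewrite /ball_ /= lp_normE b0 ltcR.
apply: h => e e0; have [|x [Vx xy]] := cy (ball y e%:C%C).
  by apply: nbhsx_ballx; rewrite ltcR.
by exists x => //; rewrite -ltcR -lp_normE; move: xy; rewrite -ball_normE.
Qed.

End LpSpace.

(** * Cheap corrections of far coordinates *)

Section Correctors.
Context {R : realType}.
Local Notation C := (R[i]).
Local Notation normc := (@ComplexField.Normc.normc R).

Lemma normc_lerB (z w : C) : normc z - normc w <= normc (z + w).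
Proof.
rewrite lerBlDr -{1}[z](addrK w); apply: le_trans (le_normcD _ _) _.
by rewrite lerD2l normcN.
Qed.

Lemma summable_tail (a : nat -> R) M e : (forall n, 0 <= a n) -> 0 < e ->
  (forall K, \sum_(0 <= n < K) a n <= M) ->
  exists N, forall K, \sum_(N <= n < K) a n <= e.
Proof.
move=> a0 e0 aM; pose S : set R := range (fun K => \sum_(0 <= n < K) a n).
have ubS : has_ubound S by exists M => _ [K _ <-].
have [|_ [N _ <-] hN] := @sup_adherent _ S e e0.
  by split => //; exists (\sum_(0 <= n < 0) a n); exists 0%N.
exists N => K; have [NK|KN] := leqP N K; last by rewrite big_geq 1?ltnW// ltW.
have : \sum_(0 <= n < K) a n <= sup S by apply: ub_le_sup => //; exists K.
by rewrite (big_cat_nat (leq0n N) NK)/=; lra.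
Qed.

Variables (p : \bar R) (p1 : (1 <= p)%E).
Implicit Types (x y z u : lp p1) (V A : set (lp p1)).

(** In A one can hit coordinates arbitrarily far out, using vectors z that are
   small compared to 1 / |u n| for any given finite family of u in A: adding a
   multiple of z to u then annihilates its n-th coordinate at a small cost. *)
Definition has_correctors A : Prop :=
  forall (us : seq (lp p1)) (N : nat) (e : R),
    (forall u, u \in us -> A u) -> 0 < e ->
  exists z n, [/\ A z, forall i, (i < N)%N -> z i = 0, z n = 1 &
    forall u, u \in us -> normc (u n) * lpN z <= e].

Lemma infinite_dim_vanish V N : linear_subspace V -> infinite_dim V ->
  exists x, [/\ V x, x != 0 & forall i, (i < N)%N -> x i = 0].
Proof.
move=> lV infV.
exact: (@infinite_dim_kernel _ _ V (fun i x => x i : C) N (@lp_eval_lin R p p1)).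
Qed.

Lemma lpN_normalize (x : lp p1) n : x n != 0 :> C ->
  lpN (((x n : C)^-1 : C) *: x) = lpN x / normc (x n).
Proof. by move=> xn; rewrite lpNZ ComplexField.Normc.normcV mulrC. Qed.

(** Replaces finitely many elements of l_p by one: the sum of their moduli. *)
Lemma lp_dominate (us : seq (lp p1)) :
  exists w : lp p1, forall u n, u \in us -> normc (u n) <= normc (w n).
Proof.
elim: us => [|u us [w hw]]; first by exists 0.
have lp_abs (v : lp p1) : exists v' : lp p1, forall n, v' n = (normc (v n))%:C%C.
  have [|v' v'E] := @lp_mk _ _ p1 (fun n => (normc (v n))%:C%C); last first.
    by exists v' => n; rewrite v'E.
  apply: (@le_lt_trans _ _ (seq_norm p v)); last by rewrite -lpNE ltry.
  by apply: seq_norm_mono => // n; rewrite normc_real ?normc_ge0.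
have [u' u'E] := lp_abs u; have [w' w'E] := lp_abs w.
exists (u' + w') => v n; rewrite inE => vus.
rewrite lp_evalD u'E w'E -rmorphD normc_real ?addr_ge0 ?normc_ge0//.
case/orP: vus => [/eqP ->|vs]; first by rewrite lerDl normc_ge0.
by apply: (le_trans (hw _ n vs)); rewrite lerDr normc_ge0.
Qed.

(** Let w dominate all the |u|. If no coordinate n of x satisfied
   ||x|| |w n| < e |x n|, then |x n| <= ||x|| |w n| / e for all n; when x vanishes
   up to a place beyond which w has norm at most e / 2, this forces
   ||x|| <= ||x|| / 2. *)
Lemma has_correctors_fin (r : R) V : p = r%:E -> 1 <= r ->
  linear_subspace V -> infinite_dim V -> has_correctors V.
Proof.
move=> pr r1 lV infV us N e usV e0.
have r0 : 0 < r by exact: lt_le_trans r1.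
have [w hw] := lp_dominate us.
have le_sum z M : 0 <= M -> lpN z <= M <->
    forall K, \sum_(0 <= n < K) normc (z n) `^ r <= M `^ r.
  move=> M0; rewrite -(seq_norm_fin_le _ r1 M0) -lee_fin lpNE.
  by rewrite {1}pr.
have [||N' hN'] := @summable_tail (fun n => normc (w n) `^ r) ((lpN w) `^ r)
    ((e / 2) `^ r) (fun n => powR_ge0 _ _).
- by rewrite powR_gt0 ?divr_gt0.
- exact/(le_sum _ _ (lpN_ge0 w)).
have [x [Vx x0 xi]] := infinite_dim_vanish (maxn N N') lV infV.
have Nx : 0 < lpN x by rewrite lpN_gt0.
have [n hn] : exists n, lpN x * normc (w n) < e * normc (x n).
  apply: contrapT => /forallNP h.
  have {}h n : normc (x n) <= lpN x / e * normc (w n).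
    have := h n; move/negP; rewrite -leNgt => hn.
    by rewrite mulrAC ler_pdivlMr// mulrC.
  suff : lpN x <= lpN x / 2 by lra.
  apply/le_sum => [|K]; first by rewrite divr_ge0// ltW.
  have xe : 0 <= lpN x / e by rewrite divr_ge0// ltW.
  have -> : (lpN x / 2) `^ r = (lpN x / e) `^ r * (e / 2) `^ r.
    by rewrite -powRM//; [congr (_ `^ _); field; rewrite gt_eqF|rewrite divr_ge0// ltW].
  apply: le_trans (_ : (lpN x / e) `^ r * \sum_(N' <= n < K) normc (w n) `^ r <= _); last first.
    by rewrite ler_wpM2l ?powR_ge0.
  have [NK|KN] := leqP N' K; last first.
    rewrite big_nat big1 ?mulr_ge0 ?sumr_ge0 ?powR_ge0// => [i _|i /andP[_ iK]].
      exact: powR_ge0.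
    rewrite xi ?(leq_trans (ltn_trans iK KN)) ?leq_maxr//.
    by rewrite ComplexField.Normc.normc0 powR0// gt_eqF.
  rewrite (big_cat_nat (leq0n N') NK)/= big_nat big1 ?add0r; last first.
    move=> i /andP[_ iN]; rewrite xi ?(leq_trans iN) ?leq_maxr//.
    by rewrite ComplexField.Normc.normc0 powR0// gt_eqF.
  rewrite mulr_sumr; apply: ler_sum => i _.
  rewrite -powRM ?normc_ge0//; apply: ge0_ler_powR; rewrite ?nnegrE ?normc_ge0//.
    exact: ltW.
  by rewrite mulr_ge0 ?normc_ge0.
have xn : 0 < normc (x n).
  rewrite -(pmulr_rgt0 _ e0); apply: le_lt_trans hn.
  by rewrite mulr_ge0 ?normc_ge0// ltW.
have xn0 : x n != 0 :> C by rewrite -normc_gt0.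
exists ((x n : C)^-1 *: x), n; split.
- exact: linear_subspaceZ.
- by move=> i iN; rewrite lp_evalZ (xi i (leq_trans iN (leq_maxl _ _))) mulr0.
- by rewrite lp_evalZ mulVf.
- move=> u /hw un; rewrite lpN_normalize// mulrA ler_pdivrMr//.
  apply: le_trans (ltW hn); rewrite mulrC.
  by apply: ler_wpM2l => //; exact: ltW.
Qed.

(** Triangular sequences by dependent choice: each vector vanishes on the
   coordinates selected before, and P records what else it owes to its
   predecessors. *)
Lemma hump_sequence (Q : lp p1 -> nat -> Prop)
    (P : seq (lp p1 * nat) -> lp p1 -> nat -> Prop) :
  (forall x n, Q x n -> x n != 0 :> C) ->
  (forall s N, (forall xn, xn \in s -> Q xn.1 xn.2) ->
    exists x n, [/\ Q x n, P s x n & forall i, (i < N)%N -> x i = 0]) ->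
  exists (u : nat -> lp p1) (m : nat -> nat), forall k,
    [/\ Q (u k) (m k), P (mkseq (fun i => (u i, m i)) k) (u k) (m k),
        forall i, (i < k)%N -> u k i = 0,
        forall j, (j < k)%N -> u k (m j) = 0 &
        forall j, (j < k)%N -> (m j < m k)%N].
Proof.
(* B s exceeds the length of s and all the coordinates selected in s *)
move=> Q0 ex; pose B (s : seq (lp p1 * nat)) := (size s + \sum_(y <- s) y.2.+1)%N.
have [s Qs|f hf] := @history_choice (lp p1 * nat)%type [set xn | Q xn.1 xn.2]
    (fun s xn => P s xn.1 xn.2 /\ forall i, (i < B s)%N -> xn.1 i = 0).
  have [x [n [Qx Px xi]]] := ex s (B s) Qs.
  by exists (x, n).
exists (fun k => (f k).1), (fun k => (f k).2) => k.
have [Qk [Pk zk]] := hf k.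
have fE : mkseq f k = mkseq (fun i => ((f i).1, (f i).2)) k.
  by apply: eq_map => i; case: (f i).
have mB j : (j < k)%N -> ((f j).2 < B (mkseq f k))%N.
  move=> jk; rewrite /B ltn_addl// (big_rem (f j))/= ?ltn_addr//.
  by apply/mapP; exists j => //; rewrite mem_iota.
split => //.
- by rewrite -fE.
- by move=> i ik; apply: zk; rewrite /B size_mkseq ltn_addr.
- by move=> j /mB; exact: zk.
- move=> j /mB jk; rewrite ltnNge; apply/negP => kj.
  by have := Q0 _ _ Qk; rewrite zk ?eqxx// (leq_ltn_trans kj).
Qed.


Lemma ultra_bounded_cvg (U : set_system nat) (g : nat -> C) M :
  UltraFilter U -> (forall j, normc (g j) <= M) ->
  exists a, forall e, 0 < e -> U [set j | normc (g j - a) <= e].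
Proof.
move=> UU gM.
have real (f : nat -> R) : (forall j, `|f j| <= M) ->
    exists a, forall e, 0 < e -> U [set j | `|f j - a| <= e].
  move=> fM; have := @segment_compact R (- M) M (f @ U) _.
  case=> [|a [_ clu]].
    rewrite /fmap/=; apply: (@filterS _ U _ setT) filterT => j _ /=.
    by rewrite in_itv/= -ler_norml.
  exists (a : R) => e e0.
  have [//|nU] := in_ultra_setVsetC [set j | `|f j - a| <= e] UU.
  have [|b [/= nb /ltW ab]] := clu
    [set b | ~~ (`|b - a| <= e)] (ball (a : R) e) _
    (nbhsx_ballx (a : R) _ e0).
    by rewrite /fmap/=; apply: (@filterS _ U) nU => j /= /negP.
  by rewrite distrC ab in nb.
have [|a ha] := real (fun j => complex.Re (g j)).
  move=> j; apply: le_trans (gM j); case: (g j) => c d /=.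
  by rewrite -sqrtr_sqr ler_wsqrtr// lerDl sqr_ge0.
have [|b hb] := real (fun j => complex.Im (g j)).
  move=> j; apply: le_trans (gM j); case: (g j) => c d /=.
  by rewrite -sqrtr_sqr ler_wsqrtr// lerDr sqr_ge0.
exists (a +i* b)%C => e e0; have e2 : 0 < e / 2 by rewrite divr_gt0.
apply: filterS (filterI (ha _ e2) (hb _ e2)) => j /=.
case: (g j) => c d /= [hc hd].
apply: (@le_trans _ _ (`|c - a| + `|d - b|)); last by lra.
rewrite -[leRHS]ger0_norm ?addr_ge0// -sqrtr_sqr ler_wsqrtr//.
rewrite -(real_normK (num_real (c - a))) -(real_normK (num_real (d - b))).
by have := normr_ge0 (c - a); have := normr_ge0 (d - b); nra.
Qed.

Lemma infinite_dim_peak V N : p = +oo%E -> linear_subspace V -> infinite_dim V ->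
  exists x n, [/\ V x, lpN x <= 1, 1 / 2 <= normc (x n) &
    forall i, (i < N)%N -> x i = 0].
Proof.
move=> poo lV infV; have [x [Vx x0 xi]] := infinite_dim_vanish N lV infV.
have Nx : 0 < lpN x by rewrite lpN_gt0.
have nNV : normc (lpN x)%:C%C^-1 = (lpN x)^-1.
  by rewrite ComplexField.Normc.normcV normc_real// ltW.
have [n hn] : exists n, lpN x / 2 < normc (x n).
  apply: contrapT => /forallNP h.
  suff : lpN x <= lpN x / 2 by lra.
  have ooP (f : nat -> C^o) M : (forall n, normc (f n) <= M) ->
    (seq_norm p f <= M%:E)%E by rewrite poo => /seq_norm_oo_le.
  by rewrite -lee_fin lpNE; apply: ooP => n; have /negP := h n; rewrite -leNgt.
exists ((lpN x)%:C%C^-1 *: x), n; split.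
- exact: linear_subspaceZ.
- by rewrite lpNZ nNV mulVf ?gt_eqF.
- rewrite lp_evalZ ComplexField.Normc.normcM nNV [leRHS]mulrC ler_pdivlMr//.
  by move: hn; lra.
- by move=> i iN; rewrite lp_evalZ (xi i iN) mulr0.
Qed.

(** Vectors with |x_k (m_k)| >= 1/2 exist in the unit ball, but nothing makes
   x_k (m_j) small for j > k. Passing to a free ultrafilter U on the indices
   gives limits a_k, and the combinations a_l x_k - a_k x_l have limit 0. If
   |a_k| <= 4 |a_l|, such a combination is large at m_k, where x_l vanishes;
   otherwise its second term dominates at m_l. *)
Lemma has_correctors_oo V : p = +oo%E -> linear_subspace V -> infinite_dim V ->
  exists2 A, A `<=` V & has_correctors A.
Proof.
move=> poo lV infV.
have [||x [m xm]] := @hump_sequence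
  (fun x n => [/\ V x, lpN x <= 1 & 1 / 2 <= normc (x n)]) (fun _ _ _ => True).
- by move=> x n [_ _ h]; rewrite -normc_gt0; lra.
- move=> s N _; have [x [n [Vx x1 xn xi]]] := infinite_dim_peak N poo lV infV.
  by exists x, n.
have [U [UU ooU]] := @ultraFilterLemma nat \oo _.
pose A := [set z | V z /\ forall e, 0 < e -> U [set j | normc (z (m j)) <= e]].
exists A => [z []//|us N e usA e0].
have /choice[a ha] k : exists a : C, forall e, 0 < e ->
    U [set j | normc ((x k (m j) : C) - a) <= e].
  apply: (@ultra_bounded_cvg U (fun j => x k (m j) : C) 1 UU) => j.
  by apply: le_trans (normc_le_lpN _ _) _; have [[]] := xm k.
have {usA} UT : U [set j | forall u, u \in us -> normc (u (m j)) <= e / 10].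
  have e10 : 0 < e / 10 by rewrite divr_gt0.
  elim: us usA => [|u us IH] usA; first by apply: filterS filterT => j _ u.
  have Au : A u by apply: usA; rewrite inE eqxx.
  have usA' v : v \in us -> A v by move=> vs; apply: usA; rewrite inE vs orbT.
  apply: filterS (filterI (proj2 Au _ e10) (IH usA')) => j /= [ju jus] v.
  by rewrite inE => /orP[/eqP ->//|]; exact: jus.
have big k : U [set j | (k <= j)%N] by apply: ooU; exact: nbhs_infty_ge.
have [k [Tk /= Nk]] := filter_ex (filterI UT (big N)).
have [l [Tl /= kl]] := filter_ex (filterI UT (big k.+1)).
have [[Vk k1 kk] _ k0 _ _] := xm k.
have [[Vl l1 ll] _ l0 lm0 _] := xm l.
have vanish i : (i < N)%N -> x k i = 0 /\ x l i = 0.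
  move=> iN; have ik := leq_trans iN Nk.
  by split; [exact: k0|apply: l0; exact: ltn_trans ik kl].
(* 10 bounds the ratio between the norm of the combination and its modulus at
   the better of the two coordinates m k and m l *)
suff [w [n [Aw wn wN Tn wi]]] : exists w n, [/\ A w, 0 < normc (w n),
    lpN w <= 10 * normc (w n), (forall u, u \in us -> normc (u n) <= e / 10) &
    forall i, (i < N)%N -> w i = 0].
  have wn0 : w n != 0 :> C by rewrite -normc_gt0.
  exists ((w n : C)^-1 *: w), n; split.
  - split; first by apply: linear_subspaceZ => //; case: Aw.
    move=> d d0; apply: filterS (proj2 Aw _ (mulr_gt0 d0 wn)) => j wj.
    change (normc ((w n : C)^-1 * w (m j)) <= d); rewrite ComplexField.Normc.normcM.
    by rewrite ComplexField.Normc.normcV mulrC ler_pdivrMr.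
  - by move=> i iN; rewrite lp_evalZ (wi i iN) mulr0.
  - by rewrite lp_evalZ mulVf.
  - move=> u /Tn un; rewrite lpN_normalize//.
    apply: (@le_trans _ _ (e / 10 * 10)); last by lra.
    by apply: ler_pM; rewrite ?normc_ge0 ?divr_ge0 ?lpN_ge0 ?normc_ge0// ler_pdivrMr.
have [ak0|ak0] := eqVneq (a k) 0.
  exists (x k), (m k); split => //.
  - by split => // d d0; apply: filterS (ha k d d0) => j /=; rewrite ak0 subr0.
  - by lra.
  - by lra.
  - by move=> i /vanish[].
pose w := a l *: x k - a k *: x l.
have Aw : A w.
  split; first by apply: linear_subspaceB => //; exact: linear_subspaceZ.
  move=> d d0; pose c := normc (a k) + normc (a l) + 1.
  have c0 : 0 < c by have := normc_ge0 (a k); have := normc_ge0 (a l); rewrite /c; lra.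
  have dc : 0 < d / c by rewrite divr_gt0.
  apply: filterS (filterI (ha k _ dc) (ha l _ dc)) => j [hk hl].
  change (normc (w (m j)) <= d).
  have -> : w (m j) = a l * (x k (m j) - a k) - a k * (x l (m j) - a l).
    by rewrite lp_evalB !lp_evalZ; ring.
  apply: le_trans (le_normcD _ _) _; rewrite normcN !ComplexField.Normc.normcM.
  apply: (@le_trans _ _ (normc (a l) * (d / c) + normc (a k) * (d / c))).
    by apply: lerD; apply: ler_wpM2l; rewrite ?normc_ge0.
  rewrite -mulrDl mulrA ler_pdivrMr// mulrC ler_pM2l//.
  by rewrite /c; lra.
have wN : lpN w <= normc (a k) + normc (a l).
  apply: le_trans (lpND _ _) _; rewrite -scaleNr !lpNZ normcN addrC.
  by apply: lerD; rewrite -[leRHS]mulr1; apply: ler_wpM2l; rewrite ?normc_ge0.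
have wk : normc (a l) / 2 <= normc (w (m k)).
  rewrite lp_evalB !lp_evalZ lm0// mulr0 subr0 ComplexField.Normc.normcM.
  by apply: ler_wpM2l; rewrite ?normc_ge0//; lra.
have wl : normc (a k) / 2 - normc (a l) <= normc (w (m l)).
  rewrite lp_evalB !lp_evalZ [X in _ <= normc X]addrC; apply: le_trans (normc_lerB _ _).
  rewrite normcN !ComplexField.Normc.normcM; apply: lerB.
    by apply: ler_wpM2l; rewrite ?normc_ge0//; lra.
  rewrite -[leRHS]mulr1; apply: ler_wpM2l; rewrite ?normc_ge0//.
  exact: le_trans (normc_le_lpN _ _) _.
have wi i : (i < N)%N -> w i = 0.
  by move=> /vanish[xi li]; rewrite lp_evalB !lp_evalZ xi li !mulr0 subr0.
have ak : 0 < normc (a k) by rewrite normc_gt0.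
have [h|h] := lerP (normc (a k)) (4 * normc (a l)).
  by exists w, (m k); split => //; lra.
have := normc_ge0 (a l) => al.
by exists w, (m l); split => //; lra.
Qed.

Lemma exists_correctors V : linear_subspace V -> infinite_dim V ->
  exists2 A, A `<=` V & has_correctors A.
Proof.
move=> lV infV; case: (p_fin_or_oo p1) => [[r pr r1]|poo].
  by exists V => //; exact: has_correctors_fin pr r1 lV infV.
exact: has_correctors_oo.
Qed.

End Correctors.

(** * Continuum many independent vectors *)

Lemma triangular_eq0 (K : fieldType) (a : nat -> nat -> K) (c : nat -> K) :
  (forall k, a k k != 0) ->
  (forall j, \sum_(0 <= k < j.+1) c k * a k j = 0) -> forall k, c k = 0.
Proof.
move=> a1 h k; elim/ltn_ind: k => k IH.
have := h k; rewrite big_nat_recr//= big_nat big1 ?add0r.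
  by move/eqP; rewrite mulf_eq0 (negbTE (a1 k)) orbF => /eqP.
by move=> i /andP[_ ik]; rewrite IH// mul0r.
Qed.

Section AlmostDisjoint.
Implicit Types t : set nat.

Definition prefix_code t (N : nat) : nat := pickle (mkseq (fun i => `[< t i >]) N).

(** Distinct subsets of nat have only finitely many initial segments in common,
   so that the sets codes t form an almost disjoint family. *)
Definition codes t : set nat := range (prefix_code t).

Lemma prefix_code_eq t t' N N' : prefix_code t N = prefix_code t' N' ->
  N = N' /\ forall i, (i < N)%N -> t i <-> t' i.
Proof.
move=> /(pcan_inj (@pickleK _)) e.
have NN' : N = N' by have := congr1 size e; rewrite !size_mkseq.
split => // i iN; have := congr1 (fun s => nth false s i) e.
rewrite !nth_mkseq -?NN'//; exact: asbool_eq_equiv.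
Qed.

Lemma prefix_code_separates t (s : seq (set nat)) :
  exists k, codes t k /\ forall t', t' \in s -> t' != t -> ~ codes t' k.
Proof.
suff [N hN] : exists N, forall t', t' \in s -> t' != t ->
    exists2 i, (i < N)%N & ~ (t i <-> t' i).
  exists (prefix_code t N); split; first by exists N.
  move=> t' /hN/[apply] -[i iN tt'] [N' _ /esym/prefix_code_eq[_ /(_ _ iN)]].
  exact: tt'.
elim: s => [|t' s [N hN]]; first by exists 0%N.
have [->|tt'] := eqVneq t' t.
  exists N => t1; rewrite inE => /orP[/eqP ->|/hN//]; by rewrite eqxx.
have [i ti] : exists i, ~ (t i <-> t' i).
  apply/existsNP => h; move/eqP: tt'; apply.
  by apply/seteqP; split => i /h.
exists (maxn N i.+1) => t1; rewrite inE => /orP[/eqP -> _|/hN/[apply] -[j jN tj]].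
  by exists i => //; rewrite leq_maxr.
by exists j => //; rewrite (leq_trans jN)// leq_maxl.
Qed.

End AlmostDisjoint.

Section Dimension.
Context {R : realType}.
Local Notation C := (R[i]).
Local Notation normc := (@ComplexField.Normc.normc R).
Variables (p : \bar R) (p1 : (1 <= p)%E).
Implicit Types (V Y : set (lp p1)).

(** Norm limits are taken coordinatewise; all the coordinates of interest are
   eventually constant along the sequences used here. *)
Lemma lp_limit_eval (v : nat -> lp p1) y n a i0 :
  (forall i, lpN (y - v i) <= 2 * 2^-1 ^+ i) ->
  (forall i, (i0 <= i)%N -> v i n = a :> C) -> y n = a :> C.
Proof.
move=> hy hv; apply/eqP; rewrite -subr_eq0; apply/negPn/negP; rewrite -normc_gt0 => ya.
have [J hJ] := @dyadic_small R (normc ((y n : C) - a) / 2) ltac:(by rewrite divr_gt0).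
have := hJ (maxn J i0) (leq_maxl _ _).
have := normc_le_lpN (y - v (maxn J i0)) n.
rewrite lp_evalB hv ?leq_maxr// => h1 h2.
by have := hy (maxn J i0); lra.
Qed.

Lemma lp_limit_in V (v : nat -> lp p1) y : closed V -> (forall i, V (v i)) ->
  (forall i, lpN (y - v i) <= 2 * 2^-1 ^+ i) -> V y.
Proof.
move=> /closed_lpP cV Vv hy; apply: cV => e e0.
have [J /(_ J (leqnn _)) hJ] := @dyadic_small R (e / 2) ltac:(by rewrite divr_gt0).
by exists (v J) => //; apply: le_lt_trans (hy J) _; lra.
Qed.

(** A sequence of complex numbers is encoded by the Dedekind cuts of the real and
   imaginary parts of its terms. *)
Lemma lp_card_le : ([set: lp p1] #<= [set: set nat])%card.
Proof.
pose f (x : lp p1) : set nat := [set k | exists n b q, k = pickle (n, b, q) /\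
  ratr q < if b then complex.Re (x n : C) else complex.Im (x n : C)].
have fI : injective f.
  move=> x y xy; apply: val_inj; apply/funext => n.
  have cut (a b : R) : (forall q : rat, ratr q < a -> ratr q < b) -> a <= b.
    move=> h; rewrite leNgt; apply/negP => ba.
    have [q] := rat_in_itvoo ba; rewrite in_itv/= => /andP[bq /h qb].
    by have := lt_trans bq qb; rewrite ltxx.
  have key x' y' : f x' = f y' -> forall b,
      (if b then complex.Re (x' n : C) else complex.Im (x' n : C)) <=
      (if b then complex.Re (y' n : C) else complex.Im (y' n : C)).
    move=> xy' b; apply: cut => q qx.
    have : f x' (pickle (n, b, q)) by exists n, b, q.
    rewrite xy' => -[n' [b' [q' [/(pcan_inj (@pickleK _))[-> -> ->]]]]].
    by [].
  have /= := (key _ _ xy true, key _ _ (esym xy) true,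
              key _ _ xy false, key _ _ (esym xy) false).
  move: (lp_val x n) (lp_val y n) => [a b] [c d] /= [[[h1 h2] h3] h4].
  by congr (_ +i* _)%C; apply/eqP; rewrite eq_le; apply/andP.
have /card_eqPle[_ fT] := @inj_card_eq _ _ [set: lp p1] f (in2W fI).
  exact: card_le_trans fT (card_leT _).
Qed.

(** Sums of a rapidly decreasing triangular sequence over the members of an
   almost disjoint family are independent: by triangularity a vanishing
   combination has all its coefficients along y equal to 0, and the coefficient
   of any one sum shows up alone at some index. *)
Lemma independent_continuum Y (y : nat -> lp p1) (n : nat -> nat) :
  linear_subspace Y -> closed Y -> (forall k, Y (y k)) ->
  (forall k j, (j < k)%N -> y k (n j) = 0) -> (forall k, y k (n k) != 0 :> C) ->
  exists x : set nat -> lp p1,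
    [/\ injective x, range x `<=` Y & lin_independent (range x)].
Proof.
move=> lY cY Yy ylow ydiag.
pose c k : C := ((2^-1 ^+ k) / (1 + lpN (y k)))%:C%C.
have y1 k : 0 < 1 + lpN (y k) by rewrite ltr_pwDl ?lpN_ge0.
have c0 k : c k != 0.
  by rewrite /c (inj_eq (@complexI _) _ 0) mulf_neq0 ?expf_neq0 ?invr_neq0// gt_eqF.
pose b t k : C := (`[< codes t k >])%:R.
pose S t i := \sum_(0 <= k < i) (b t k * c k) *: y k.
have YS t i : Y (S t i).
  rewrite /S; elim: i => [|i IH]; first by rewrite big_nil; case: lY; rewrite inE.
  by rewrite big_nat_recr//=; apply: linear_subspaceD => //; exact: linear_subspaceZ.
have /choice[x hx] t : exists x, forall i, lpN (x - S t i) <= 2 * 2^-1 ^+ i.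
  apply: lp_complete => i; rewrite /S big_nat_recr//= addrC addrK lpNZ.
  rewrite ComplexField.Normc.normcM /c normc_real; last first.
    by rewrite divr_ge0 ?exprn_ge0// ltW.
  have b1 : normc (b t i) <= 1.
    rewrite /b; case: asboolP => _; first by rewrite ComplexField.Normc.normc1.
    by rewrite ComplexField.Normc.normc0.
  rewrite -mulrA -[leRHS]mul1r; apply: ler_pM => //; first exact: normc_ge0.
    by rewrite mulr_ge0 ?lpN_ge0// divr_ge0 ?exprn_ge0// ltW.
  rewrite mulrAC ler_pdivrMr//; apply: ler_wpM2l; first exact: exprn_ge0.
  by rewrite lerDr.
have xE t j : x t (n j) = \sum_(0 <= k < j.+1) b t k * c k * y k (n j) :> C.
  apply: (@lp_limit_eval (S t) _ _ _ j.+1 (hx t)) => i ji.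
  rewrite /S lp_eval_sum (big_cat_nat (leq0n j.+1) ji)/=.
  rewrite [X in _ + X]big_nat [X in _ + X]big1.
    by rewrite addr0; apply: eq_bigr => k _.
  move=> k /andP[jk _]; change (b t k * c k * (y k (n j) : C) = 0).
  by rewrite ylow// mulr0.
have indx (s : seq (set nat)) (a : set nat -> C) : uniq s ->
    \sum_(t <- s) a t *: x t = 0 -> forall t, t \in s -> a t = 0.
  move=> us sum0 t ts.
  have B0 : forall k, (\sum_(t <- s) a t * b t k) * c k = 0.
    apply: (@triangular_eq0 _ (fun k j => y k (n j) : C)) => // j.
    transitivity ((\sum_(t <- s) a t *: x t) (n j) : C); last by rewrite sum0.
    rewrite lp_eval_sum; under [RHS]eq_bigr do rewrite lp_evalZ xE mulr_sumr.
    rewrite [RHS]exchange_big/=; apply: eq_bigr => k _.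
    rewrite -mulrA mulr_suml; apply: eq_bigr => t' _; ring.
  have [k [tk sk]] := prefix_code_separates t s.
  have /eqP := B0 k; rewrite mulf_eq0 (negbTE (c0 k)) orbF => /eqP.
  rewrite (bigD1_seq t)//= big1_seq ?addr0; last first.
    by move=> t' /andP[t't t's]; rewrite /b asboolF ?mulr0//; exact: sk.
  by rewrite /b asboolT// mulr1.
have xI : injective x.
  move=> t t' xx; apply: contrapT => /eqP tt'.
  have := indx [:: t; t'] (fun z => if z == t then 1 else -1).
  rewrite /= inE tt' big_cons big_seq1 eqxx eq_sym (negbTE tt') scaleN1r scale1r xx subrr.
  move=> /(_ isT erefl t); rewrite inE eqxx => /(_ isT) /eqP.
  by rewrite oner_eq0.
exists x; split => //.
  by move=> _ [t _ <-]; exact: lp_limit_in (YS t) (hx t).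
move=> s a us sx sum0.
have /choice[T hT] z : exists t, z \in s -> x t = z.
  have [/sx[t _ <-]|] := boolP (z \in s); first by exists t.
  by move=> _; exists set0.
have sE : [seq x t | t <- [seq T z | z <- s]] = s.
  by rewrite -map_comp -[RHS]map_id; apply/eq_in_map => z /hT.
move=> z zs; rewrite -(hT z zs).
apply: (indx [seq T z | z <- s] (fun t => a (x t))).
- by rewrite -(map_inj_uniq xI) sE.
- by rewrite -[RHS]sum0 big_map; apply: eq_big_seq => z' z's; rewrite hT.
- exact: map_f.
Qed.

End Dimension.

(** * Subspaces with infinitely many common zeros *)

Section CommonZeros.
Context {R : realType}.
Local Notation C := (R[i]).
Local Notation normc := (@ComplexField.Normc.normc R).
Variables (p : \bar R) (p1 : (1 <= p)%E).
Implicit Types (V Y : set (lp p1)).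

(** The matrix of the u k (m i) is unitriangular, with its other half so small
   that the corrections of any u k sum up to a convergent series; the factor
   i.+1 leaves room for the coordinates of u k to grow while it is corrected. *)
Record almost_biorthogonal V (u : nat -> lp p1) (m : nat -> nat) : Prop := {
  abo_in : forall k, V (u k) ;
  abo_diag : forall k, u k (m k) = 1 ;
  abo_low : forall k j, (j < k)%N -> u k (m j) = 0 ;
  abo_up : forall k i, (k < i)%N ->
    normc (u k (m i)) * lpN (u i) <= 2^-1 ^+ i / i.+1%:R ;
  abo_incr : forall i j, (i < j)%N -> (m i < m j)%N }.

Lemma exists_almost_biorthogonal V : linear_subspace V -> infinite_dim V ->
  exists u m, almost_biorthogonal V u m.
Proof.
move=> lV infV; have [A AV corA] := exists_correctors lV infV.
have [||u [m um]] := @hump_sequence R p p1 (fun x n => A x /\ x n = 1)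
  (fun s x n => forall yn, yn \in s ->
     normc (yn.1 n) * lpN x <= 2^-1 ^+ size s / (size s).+1%:R).
- by move=> x n [_ ->]; exact: oner_neq0.
- move=> s N As.
  have [||x [n [Ax xi xn sx]]] :=
    corA [seq yn.1 | yn <- s] N (2^-1 ^+ size s / (size s).+1%:R).
  + by move=> _ /mapP[yn /As[? _] ->].
  + by rewrite divr_gt0 ?exprn_gt0.
  by exists x, n; split => // yn ys; apply: sx; exact: map_f.
exists u, m; split.
- by move=> k; have [[/AV]] := um k.
- by move=> k; have [[]] := um k.
- by move=> k j; have [_ _ _ h _] := um k; exact: h.
- move=> k i ki; have [_ h _ _ _] := um i; rewrite size_mkseq in h.
  by apply: (h (u k, m k)); apply/mapP; exists k => //; rewrite mem_iota.
- by move=> i j; have [_ _ _ _ h] := um j; exact: h.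
Qed.

(** Correct u k by multiples of the u i (i in P), in turn: the i-th step kills
   the coordinate m i and, by triangularity, spoils neither the coordinates
   m j for j < i nor those for j <= k; almost biorthogonality makes the
   corrections summable. *)
Lemma corrected_vector V u m (P : pred nat) k : linear_subspace V -> closed V ->
  almost_biorthogonal V u m -> ~~ P k ->
  exists y, [/\ V y, forall i, P i -> y (m i) = 0,
    forall j, (j < k)%N -> y (m j) = 0 & y (m k) = 1].
Proof.
move=> lV cV [uV u1 ulow uup _] Pk.
pose v := fix v i : lp p1 :=
  if i is i'.+1 then v i' - (if P i' then (v i' (m i') : C) else 0) *: u i' else u k.
pose c i : C := if P i then (v i (m i) : C) else 0.
have vS i : v i.+1 = v i - c i *: u i by [].
have vSE i n : v i.+1 n = v i n - c i * u i n :> C by [].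
have vk i : (i <= k.+1)%N -> v i = u k.
  elim: i => // i IH ik; rewrite vS /c IH ?(ltnW ik)//.
  case: ifP => Pi; last by rewrite scale0r subr0.
  rewrite ulow ?scale0r ?subr0//; move: ik; rewrite ltnS leq_eqVlt => /predU1P[ik|//].
  by rewrite ik (negbTE Pk) in Pi.
have c0 i : (i <= k)%N -> c i = 0.
  move=> ik; rewrite /c vk ?leqW//; case: ifP => Pi //.
  move: ik; rewrite leq_eqVlt => /predU1P[ik|/ulow//].
  by rewrite ik (negbTE Pk) in Pi.
have u_ge1 i : 1 <= lpN (u i).
  by have := normc_le_lpN (u i) (m i); rewrite u1 ComplexField.Normc.normc1.
pose eps i : R := 2^-1 ^+ i / i.+1%:R.
have eps0 i : 0 <= eps i by rewrite divr_ge0// exprn_ge0.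
(* the bound on the coordinates of v i implies the bound on the i-th correction,
   which in turn yields the bound on the coordinates of v i.+1 *)
have cbound i : (forall j, (i <= j)%N -> (k < j)%N ->
    normc (v i (m j)) * lpN (u j) <= i.+1%:R * eps j) ->
    normc (c i) * lpN (u i) <= 2^-1 ^+ i.
  move=> h; have [ik|ki] := leqP i k.
    by rewrite c0// ComplexField.Normc.normc0 mul0r exprn_ge0.
  rewrite /c; case: ifP => _; last first.
    by rewrite ComplexField.Normc.normc0 mul0r exprn_ge0.
  apply: le_trans (h i (leqnn _) ki) _.
  by rewrite /eps mulrC divfK// pnatr_eq0.
have vbound i j : (i <= j)%N -> (k < j)%N ->
    normc (v i (m j)) * lpN (u j) <= i.+1%:R * eps j.
  elim: i j => [|i IH] j ij kj; first by rewrite mul1r; exact: uup.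
  have ci : normc (c i) <= 1.
    rewrite -[leLHS]mulr1; apply: le_trans (_ : normc (c i) * lpN (u i) <= _).
      by apply: ler_wpM2l; rewrite ?normc_ge0.
    by apply: le_trans (cbound i IH) _; rewrite exprn_ile1// invf_le1// ler1n.
  rewrite vSE -[i.+2]addn1 natrD mulrDl.
  apply: le_trans (_ : (normc (v i (m j)) + normc (c i * u i (m j))) * lpN (u j) <= _).
    apply: ler_wpM2r; first exact: lpN_ge0.
    by apply: le_trans (le_normcD _ _) _; rewrite normcN.
  rewrite mulrDl; apply: lerD; first by apply: IH => //; exact: ltnW.
  rewrite ComplexField.Normc.normcM -mulrA; apply: ler_pM => //.
  - exact: normc_ge0.
  - by rewrite mulr_ge0 ?normc_ge0 ?lpN_ge0.
  - exact: uup.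
have [i|y hy] := @lp_complete _ _ _ v.
  rewrite vS addrC addKr -scaleNr lpNZ normcN; apply: cbound => j ij kj; exact: vbound.
have Vv i : V (v i).
  elim: i => [|i IH]; first exact: uV.
  rewrite vS; apply: linear_subspaceB => //.
  exact: linear_subspaceZ.
have vlow i j : (j <= k)%N -> v i (m j) = u k (m j).
  move=> jk; elim: i => // i IH; rewrite vSE.
  have [ik|ki] := leqP i k; first by rewrite c0// mul0r subr0.
  by rewrite ulow ?mulr0 ?subr0// (leq_ltn_trans jk).
exists y; split.
- exact: lp_limit_in cV Vv hy.
- move=> i Pi; apply: (@lp_limit_eval _ _ _ v y _ 0 i.+1 hy).
  elim=> // j IH; rewrite ltnS leq_eqVlt => /predU1P[<-|ij]; rewrite vSE.
    by rewrite u1 mulr1 /c Pi subrr.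
  by rewrite ulow// mulr0 subr0; exact: IH.
- move=> j jk; apply: (@lp_limit_eval _ _ _ v y _ 0 0%N hy) => i _.
  by rewrite vlow ?(ltnW jk)// ulow.
- by apply: (@lp_limit_eval _ _ _ v y _ 1 0%N hy) => i _; rewrite vlow.
Qed.

End CommonZeros.

Theorem theorem5p1 (R : realType) (p : \bar R) (p1 : (1 <= p)%E)
    (V : set (lp p1)) :
  linear_subspace V -> closed V -> infinite_dim V ->
  maximal_spaceable V (V `\` finitely_many_zeros V).
Proof.
move=> lV cV infV.
have [u [m um]] := exists_almost_biorthogonal lV infV.
pose Y : set (lp p1) := [set x | V x /\ forall i, odd i -> x (m i) = 0].
have YV : Y `<=` V by move=> x [].
have lY : linear_subspace Y.
  split; first by rewrite inE; split=> //; case: lV; rewrite inE.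
  move=> a x y; rewrite !inE => -[Vx x0] [Vy y0]; split.
    by apply: linear_subspaceD => //; exact: linear_subspaceZ.
  by move=> i oi; rewrite lp_evalD lp_evalZ x0// y0// mulr0 addr0.
have cY : closed Y.
  apply/closed_lpP => y hy; split.
    by move/closed_lpP: cV; apply => e /hy[x [Vx _] xy]; exists x.
  move=> i oi; apply/eqP/negPn/negP; rewrite -normc_gt0 => /hy[x [_ x0]].
  have := normc_le_lpN (y - x) (m i); rewrite lp_evalB x0// subr0 => h1 h2.
  by have := le_lt_trans h1 h2; rewrite ltxx.
have /choice[y hy] k : exists y, [/\ V y, forall i, odd i -> y (m i) = 0,
    forall j, (j < k.*2)%N -> y (m j) = 0 & y (m k.*2) = 1].
  by apply: (corrected_vector (P := odd) lV cV um); rewrite odd_double.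
have [|||x [xI xY indx]] := @independent_continuum _ _ _ Y y (fun k => m k.*2) lY cY.
- by move=> k; have [? ? _ _] := hy k.
- by move=> k j jk; have [_ _ h _] := hy k; apply: h; rewrite ltn_double.
- by move=> k; have [_ _ _ ->] := hy k; exact: oner_neq0.
have infY : infinite_dim Y.
  apply: (@infinite_dim_seq _ _ _ (fun k => x [set k])).
  - by move=> i j /xI /seteqP[/(_ i erefl)].
  - by move=> _ [k _ <-]; apply: xY; exists [set k].
  - by move=> s c us sx; apply: indx us _ => z /sx[k _ <-]; exists [set k].
have mI : injective m.
  move=> i j mij; case: (ltngtP i j) => // /(abo_incr um); by rewrite mij ltnn.
exists Y.
  split => //.
    by apply/closed_subspaceP; exists Y.
  move=> z Yz; left; split; first exact: YV.
  case: Yz => _ z0 [_ finz]; apply: infinite_nat.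
  have /eq_finite_set <- := @inj_card_eq _ _ setT (fun k => m k.*2.+1)
    (in2W (fun i j ij => double_inj (succn_inj (mI _ _ ij)))).
  by apply: sub_finite_set finz => _ [k _ <-] /=; apply: z0; rewrite oddS odd_double.
have [B xB bB] := hamel_basis_extend lY xY indx.
have [D BD bD] : exists2 D, B `<=` D & hamel_basis D V.
  by case: bB => BY indB _; apply: hamel_basis_extend => // z /BY/YV.
exists B, D; split => //; apply/card_eqPle; split; first exact: subset_card_le.
apply: card_le_trans (card_leT _) _; apply: card_le_trans (lp_card_le p1) _.
apply: card_le_trans (subset_card_le xB).
by have /card_eqPle[] := @inj_card_eq _ _ setT x (in2W xI).
Qed.
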